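(* Let $\Phi=(\phi_1,\dots,\phi_K)$, $\phi_i\in\mathbb{R}^d$, be a unit norm tight frame with frame constant $A=K/d$ and coherence $\mu$. Let $c\in\mathbb{R}^K$ satisfy $c_1\ge c_2\ge\dots\ge c_K\ge 0$ and $\|c\|_2=1$, and let $x=c_{p,\sigma}$ with probability $(2^K K!)^{-1}$ for each permutation $p$ of $\{1,\dots,K\}$ and each sign sequence $\sigma\in\{-1,1\}^K$; set $y=\Phi x$. If $c_1>c_2+2\mu\|c\|_1$, then $\Phi$ is a local maximum of $$\max_{\Psi\in\mathcal D}\ \mathbb{E}_y\big(\|\Psi^\star y\|_\infty^2\big).$$ Moreover, for every $\Psi=(\psi_1,\dots,\psi_K)\in\mathcal D$ with $0<\max_i\|\psi_i-\phi_i\|_2\le\varepsilon$ we have $\mathbb{E}_x\|\Psi^\star\Phi x\|_\infty^2<\mathbb{E}_x\|\Phi^\star\Phi x\|_\infty^2$ as soon as $\varepsilon<1/5$ and $$\varepsilon\le\frac{\Big(1-2\frac{c_2+\mu\|c\|_1}{c_2+c_1}\Big)^2}{2A\log\Big(2AK\big/\big(c_1^2-\frac{1-c_1^2}{K-1}\big)\Big)}.$$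
   Context: $\mathcal D$ denotes the set of dictionaries $\Psi=(\psi_1,\dots,\psi_K)$ with $\psi_i\in\mathbb{R}^d$, $\|\psi_i\|_2=1$. A unit norm tight frame with frame constant $A$ is a dictionary in $\mathcal D$ with $\sum_{i=1}^K|\langle\phi_i,v\rangle|^2=A\|v\|_2^2$ for all $v\in\mathbb{R}^d$ (so $A=K/d$). The coherence is $\mu=\max_{i\neq j}|\langle\phi_i,\phi_j\rangle|$. For a sequence $c\in\mathbb{R}^K$, a permutation $p$ and signs $\sigma$, $c_{p,\sigma}\in\mathbb{R}^K$ is defined componentwise by $c_{p,\sigma}(i)=\sigma_i c_{p(i)}$. $\Psi^\star$ denotes the transpose. *)

(* Defs.v *)
From HB Require Import structures.
From Stdlib Require Import Reals.
From mathcomp Require Import all_boot all_fingroup.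
Set Implicit Arguments. Unset Strict Implicit. Unset Printing Implicit Defensive.

Local Open Scope R_scope.

Lemma Rplus_assoc' : associative Rplus.
Proof. by move=> x y z; rewrite Rplus_assoc. Qed.
HB.instance Definition _ := Monoid.isComLaw.Build R 0 Rplus Rplus_assoc' Rplus_comm Rplus_0_l.

Definition dot (d : nat) (u v : 'I_d -> R) : R := \big[Rplus/0]_(j < d) (u j * v j).
Definition norm2 (d : nat) (u : 'I_d -> R) : R := sqrt (dot u u).
Definition linf (n : nat) (v : 'I_n -> R) : R :=
  foldr Rmax 0 [seq Rabs (v i) | i <- enum 'I_n].

Definition dict (d K : nat) := 'I_K -> 'I_d -> R.

Definition in_D (d K : nat) (Psi : dict d K) : Prop := forall i, norm2 (Psi i) = 1.

Definition is_untf (d K : nat) (Phi : dict d K) (A : R) : Prop :=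
  in_D Phi /\ forall v : 'I_d -> R, \big[Rplus/0]_(i < K) (dot (Phi i) v) ^ 2 = A * dot v v.

Definition coherence (d K : nat) (Phi : dict d K) : R :=
  foldr Rmax 0 [seq Rabs (dot (Phi ij.1) (Phi ij.2))
               | ij <- enum [pred ij : 'I_K * 'I_K | ij.1 != ij.2]].

Definition analysis (d K : nat) (Psi : dict d K) (v : 'I_d -> R) : 'I_K -> R :=
  fun i => dot (Psi i) v.

Definition synthesis (d K : nat) (Phi : dict d K) (x : 'I_K -> R) : 'I_d -> R :=
  fun j => \big[Rplus/0]_(i < K) (x i * Phi i j).

(* the coefficient sequence c is given as c : nat -> R, with c_1,...,c_K the
   values c 0, ..., c (K-1) (0-based indexing). *)
Definition sgn (b : bool) : R := if b then -1 else 1.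

Definition cps (K : nat) (c : nat -> R) (p : {perm 'I_K}) (s : {ffun 'I_K -> bool}) : 'I_K -> R :=
  fun i => sgn (s i) * c (nat_of_ord (p i)).

Definition Ex (K : nat) (c : nat -> R) (f : ('I_K -> R) -> R) : R :=
  / (INR (2 ^ K)%N * INR (K `!)%N) *
  \big[Rplus/0]_(p : {perm 'I_K}) \big[Rplus/0]_(s : {ffun 'I_K -> bool}) f (cps c p s).

Definition objective (d K : nat) (Phi : dict d K) (c : nat -> R) (Psi : dict d K) : R :=
  Ex c (fun x => (linf (analysis Psi (synthesis Phi x))) ^ 2).

Definition dict_dist (d K : nat) (Psi Phi : dict d K) : R :=
  foldr Rmax 0 [seq norm2 (fun j => Psi i j - Phi i j) | i <- enum 'I_K].

Definition local_max_on_D (d K : nat) (F : dict d K -> R) (Phi : dict d K) : Prop :=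
  exists r : R, 0 < r /\
    forall Psi : dict d K, in_D Psi -> dict_dist Psi Phi < r -> F Psi <= F Phi.

(* Main.v *)
(** Write [psi_j = alpha_j phi_j + r_j] with [r_j] orthogonal to [phi_j], put
    [w_j = 1 - alpha_j^2 = |r_j|^2], and let [i] be the index that carries the
    largest coefficient [c_1].  For fixed [p] the correlations [<r_j, y>] are
    Rademacher sums, of variance at most [A w_j c_2^2] for [j = i] (because
    [r_i] does not see [phi_i]) and at most [A w_j c_1^2] otherwise.  Unless one
    of them exceeds [c_2 t], resp. [c_1 t], with [t = delta - eps^2/2] and
    [delta = (c_1 - c_2 - 2 mu |c|_1) / (c_1 + c_2)], the maximal correlation of
    [y] with [Psi] is attained at [i].  Hoeffding's inequality and
    [|Psi^* y|_oo^2 <= A] bound the contribution of the exceptional signs by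
    [2 A sum_j exp (- t^2 / (2 A w_j))], whereas replacing [psi_i] by [phi_i] in
    [E <psi_i, y>^2] gains exactly [(lambda / K) sum_j w_j] with
    [lambda = c_1^2 - (1 - c_1^2) / (K - 1)].  The bound on [eps] makes the
    gain larger, term by term. *)

Require Import Defs.
From HB Require Import structures.
From Stdlib Require Import Reals Psatz Classical FunctionalExtensionality.
From Coquelicot Require Import Coquelicot.
From mathcomp Require Import all_boot all_fingroup.
Set Implicit Arguments. Unset Strict Implicit. Unset Printing Implicit Defensive.
Local Open Scope R_scope.

(** * Finite sums of reals *)

Lemma RmultA : associative Rmult.
Proof. by move=> x y z; rewrite Rmult_assoc. Qed.

HB.instance Definition _ :=
  Monoid.isMulLaw.Build R 0 Rmult Rmult_0_l Rmult_0_r.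
HB.instance Definition _ :=
  Monoid.isComLaw.Build R 1 Rmult RmultA Rmult_comm Rmult_1_l.
HB.instance Definition _ :=
  Monoid.isAddLaw.Build R Rmult Rplus Rmult_plus_distr_r Rmult_plus_distr_l.

Local Notation "\rsum_ ( i : t ) F" := (\big[Rplus/0]_(i : t) F)
  (at level 41, F at level 41, i, t at level 50).
Local Notation "\rsum_ ( i < n ) F" := (\big[Rplus/0]_(i < n) F)
  (at level 41, F at level 41, i, n at level 50).

Lemma rsumZ (I : Type) (r : seq I) (P : pred I) (x : R) (F : I -> R) :
  \big[Rplus/0]_(i <- r | P i) (x * F i) = x * \big[Rplus/0]_(i <- r | P i) F i.
Proof. by rewrite big_distrr. Qed.

Lemma rsumD (I : Type) (r : seq I) (P : pred I) (F G : I -> R) :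
  \big[Rplus/0]_(i <- r | P i) (F i + G i)
  = \big[Rplus/0]_(i <- r | P i) F i + \big[Rplus/0]_(i <- r | P i) G i.
Proof. by rewrite big_split. Qed.

Lemma rsum_le (I : Type) (r : seq I) (P : pred I) (F G : I -> R) :
  (forall i, P i -> F i <= G i) ->
  \big[Rplus/0]_(i <- r | P i) F i <= \big[Rplus/0]_(i <- r | P i) G i.
Proof.
move=> H; apply: (big_ind2 (fun a b => a <= b)) => //; first by lra.
by move=> *; lra.
Qed.

Lemma rsum_ge0 (I : Type) (r : seq I) (P : pred I) (F : I -> R) :
  (forall i, P i -> 0 <= F i) -> 0 <= \big[Rplus/0]_(i <- r | P i) F i.
Proof.
move=> H; apply: (big_ind (fun a => 0 <= a)) => //; first by lra.
by move=> *; lra.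
Qed.

Lemma rsum_abs (I : Type) (r : seq I) (P : pred I) (F : I -> R) :
  Rabs (\big[Rplus/0]_(i <- r | P i) F i)
  <= \big[Rplus/0]_(i <- r | P i) Rabs (F i).
Proof.
apply: (big_ind2 (fun a b => Rabs a <= b)).
- by rewrite Rabs_R0; lra.
- by move=> a b a' b' H H'; have := Rabs_triang a a'; lra.
- by move=> *; lra.
Qed.

Lemma rsum_lt (I : finType) (i0 : I) (F G : I -> R) :
  (forall i, F i <= G i) -> F i0 < G i0 -> \rsum_(i : I) F i < \rsum_(i : I) G i.
Proof.
move=> H H0; rewrite (bigD1 i0) // [X in _ < X](bigD1 i0) //=.
by apply: Rplus_lt_le_compat => //; apply: rsum_le.
Qed.

Lemma rsum_term_le (I : finType) (F : I -> R) (i0 : I) :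
  (forall i, 0 <= F i) -> F i0 <= \rsum_(i : I) F i.
Proof.
move=> H; rewrite (bigD1 i0) //=.
have := @rsum_ge0 _ (index_enum I) (fun i => i != i0) F (fun i _ => H i).
by lra.
Qed.

Lemma rsum_const (I : finType) (P : pred I) (x : R) :
  \big[Rplus/0]_(i | P i) x = INR #|P| * x.
Proof.
rewrite big_const; elim: #|P| => [|n IH]; first by rewrite /=; lra.
by rewrite iterS IH S_INR; lra.
Qed.

Lemma rsum_sqr_eq0 (I : finType) (u : I -> R) :
  \rsum_(i : I) u i ^ 2 <= 0 -> forall i, u i = 0.
Proof.
move=> H i; have := @rsum_term_le _ (fun i => u i ^ 2) i (fun i => pow2_ge_0 _).
rewrite {1}/pow => Hi; apply: Rsqr_0_uniq; rewrite /Rsqr.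
by have := Rle_0_sqr (u i); rewrite /Rsqr; lra.
Qed.

(** The sum of the squares of [V * u i - C * v i] is nonnegative and equals [V * (U * V - C ^ 2)]; a
    vanishing [V] forces [v = 0] and is treated apart. *)
Lemma rsum_cauchy (I : finType) (u v : I -> R) :
  (\rsum_(i : I) u i * v i) ^ 2 <= (\rsum_(i : I) u i ^ 2) * (\rsum_(i : I) v i ^ 2).
Proof.
have Hq p q : \rsum_(i : I) (p * u i - q * v i) ^ 2 = p * p * (\rsum_(i : I) u i ^ 2)
    + (-2 * p * q * (\rsum_(i : I) u i * v i) + q * q * (\rsum_(i : I) v i ^ 2)).
  rewrite !big_distrr /= -!big_split /=.
  by apply: eq_bigr => i _; rewrite /=; ring.
set C := \rsum_(i : I) (u i * v i); set U := \rsum_(i : I) _.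
set V := \rsum_(i : I) v i ^ 2.
have V0 : 0 <= V by apply: rsum_ge0 => i _; apply: pow2_ge_0.
have U0 : 0 <= U by apply: rsum_ge0 => i _; apply: pow2_ge_0.
case: (Rle_lt_dec V 0) => [V0'|Vp].
  have v0 := rsum_sqr_eq0 V0'.
  have -> : C = 0 by rewrite /C big1 // => i _; rewrite v0; lra.
  by rewrite /= Rmult_0_l; apply: Rmult_le_pos.
have : 0 <= \rsum_(i : I) (V * u i - C * v i) ^ 2.
  by apply: rsum_ge0 => i _; apply: pow2_ge_0.
rewrite Hq -/U -/C -/V.
move=> H; have : 0 <= V * (U * V - C ^ 2) by rewrite /=; lra.
by move=> H'; nra.
Qed.

(** * Hoeffding's inequality and second moments for Rademacher sums *)

Lemma exp_le (x y : R) : x <= y -> exp x <= exp y.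
Proof.
by case=> [H|->]; [apply: Rlt_le; apply: exp_increasing|apply: Rle_refl].
Qed.

(** This is tanh x <= x without division: the difference of the two sides vanishes at 0 and has
    derivative [y * (exp y - exp (- y))], nonnegative for [y >= 0]. *)
Lemma tanh_le (x : R) : 0 <= x -> exp x - exp (- x) <= x * (exp x + exp (- x)).
Proof.
move=> x0; case: (Req_dec x 0) => [->|xn]; first by rewrite Ropp_0 exp_0; lra.
pose f y := y * (exp y + exp (- y)) - (exp y - exp (- y)).
pose f' y := y * (exp y - exp (- y)).
have [y [+ [Hy1 Hy2]]] : exists c, f x - f 0 = f' c * (x - 0) /\ 0 < c < x.
  apply: MVT_cor2; first by lra.
  move=> c _; apply/is_derive_Reals; rewrite /f /f'; auto_derive => //; ring.
rewrite /f /f' Rmult_0_l Ropp_0 exp_0 => Hy.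
have : exp (- y) < exp y by apply: exp_increasing; lra.
move=> He; have : 0 <= y * (exp y - exp (- y)) * (x - 0).
  by apply: Rmult_le_pos; [apply: Rmult_le_pos|]; lra.
by lra.
Qed.

(** Both sides are even, and by [tanh_le] the quotient of 2 cosh y by exp (y^2 / 2) does not
    increase for y > 0, starting from 2 at 0. *)
Lemma cosh_le_exp_sqr (x : R) : exp x + exp (- x) <= 2 * exp (x ^ 2 / 2).
Proof.
wlog x0 : x / 0 < x => [H|].
  case: (Rtotal_order x 0) => [xn|[->|xp]]; last exact: H.
    have := H (- x) ltac:(lra); rewrite Ropp_involutive.
    by have -> : (- x) ^ 2 = x ^ 2 by [rewrite /=; ring]; lra.
  by rewrite Ropp_0 (_ : 0 ^ 2 / 2 = 0) ?exp_0 /=; lra.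
pose f y := exp (- (y ^ 2 / 2)) * (exp y + exp (- y)).
pose f' y := exp (- (y ^ 2 / 2)) * (exp y - exp (- y) - y * (exp y + exp (- y))).
have [y [+ [Hy1 Hy2]]] : exists c, f x - f 0 = f' c * (x - 0) /\ 0 < c < x.
  apply: MVT_cor2; first by lra.
  move=> c _; apply/is_derive_Reals; rewrite /f /f'; auto_derive => //.
  by rewrite /Rdiv /=; field.
rewrite {2}/f /f' Ropp_0 (_ : - (0 ^ 2 / 2) = 0) ?exp_0 => [Hy|]; last by rewrite /=; lra.
have Ht := @tanh_le y ltac:(lra).
have E0 := exp_pos (- (y ^ 2 / 2)).
have : f x <= 2.
  have : 0 <= exp (- (y ^ 2 / 2)) * (y * (exp y + exp (- y)) - (exp y - exp (- y))).
    by apply: Rmult_le_pos; lra.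
  by move=> H; nra.
rewrite /f exp_Ropp => H.
have E1 := exp_pos (x ^ 2 / 2).
apply: (Rmult_le_reg_l (/ exp (x ^ 2 / 2))); first exact: Rinv_0_lt_compat.
by apply: (Rle_trans _ _ _ H); rewrite Rmult_comm Rmult_assoc Rinv_r; lra.
Qed.

Definition rademacher (K : nat) (a : 'I_K -> R) (s : {ffun 'I_K -> bool}) : R :=
  \rsum_(l < K) sgn (s l) * a l.

Lemma exp_rsum (I : Type) (r : seq I) (P : pred I) (F : I -> R) :
  exp (\big[Rplus/0]_(i <- r | P i) F i) = \big[Rmult/1]_(i <- r | P i) exp (F i).
Proof. by apply: (big_morph exp exp_plus exp_0). Qed.

Lemma INR_exp2 (n : nat) : INR (2 ^ n)%N = 2 ^ n.
Proof. by elim: n => [|n IH] //=; rewrite expnS mult_INR IH. Qed.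

(** Independence of the signs: the sum over all patterns of a product factors over the coordinates,
    and [cosh_le_exp_sqr] bounds each factor. *)
Lemma rademacher_mgf (K : nat) (a : 'I_K -> R) :
  \rsum_(s : {ffun 'I_K -> bool}) exp (rademacher a s)
  <= 2 ^ K * exp (\rsum_(l < K) a l ^ 2 / 2).
Proof.
under eq_bigr do rewrite /rademacher exp_rsum.
rewrite -(bigA_distr_bigA (fun l b => exp (sgn b * a l))) /=.
rewrite exp_rsum.
have -> : 2 ^ K = \big[Rmult/1]_(l < K) 2.
  rewrite big_const card_ord; elim: {a} K => [|n IH] //=.
  by rewrite IH.
rewrite -big_split /=.
apply: (@proj2 (0 <= \big[Rmult/1]_(i < K) \big[Rplus/0]_j exp (sgn j * a i))).
apply: (big_ind2 (fun x y => 0 <= x /\ x <= y)).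
- by lra.
- move=> x1 x2 y1 y2 [? ?] [? ?]; split; first exact: Rmult_le_pos.
  exact: Rmult_le_compat.
- move=> i _; have -> : \big[Rplus/0]_j exp (sgn j * a i) = exp (a i) + exp (- a i).
    rewrite big_bool /= (_ : -1 * a i = - a i) 1?(_ : 1 * a i = a i); [|lra..].
    exact: Rplus_comm.
  split; last exact: cosh_le_exp_sqr.
  by have := exp_pos (a i); have := exp_pos (- a i); lra.
Qed.

Definition ind (b : bool) : R := if b then 1 else 0.

Lemma rademacher_scale (K : nat) (a : 'I_K -> R) (x : R) s :
  rademacher (fun l => x * a l) s = x * rademacher a s.
Proof. by rewrite /rademacher big_distrr /=; apply: eq_bigr => l _; ring. Qed.

Definition Rltb (x y : R) : bool := if Rlt_dec x y then true else false.

Lemma RltP x y : reflect (x < y) (Rltb x y).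
Proof. by rewrite /Rltb; case: Rlt_dec => H; constructor. Qed.

(** Chernoff's method. The scale [b] is kept apart from [V] because it will be c_1 or c_2, and c_2
    may be zero. *)
Lemma rademacher_tail (K : nat) (a : 'I_K -> R) (V t b : R) :
  0 < V -> 0 <= t -> 0 <= b -> \rsum_(l < K) a l ^ 2 <= b ^ 2 * V ->
  \rsum_(s : {ffun 'I_K -> bool}) ind (Rltb (b * t) (Rabs (rademacher a s)))
  <= 2 ^ K * (2 * exp (- (t ^ 2 / (2 * V)))).
Proof.
move=> V0 t0 b0 Ha.
have P2 : 0 < 2 ^ K by apply: pow_lt; lra.
(* With [b = 0] all coefficients vanish and the strict event is empty. *)
case: (Req_dec b 0) => [be|bn].
  have a0 : forall l, a l = 0.
    by apply: rsum_sqr_eq0; move: Ha; rewrite be /=; lra.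
  rewrite big1 => [|s _].
    apply: Rmult_le_pos; first by lra.
    by have := exp_pos (- (t ^ 2 / (2 * V))); lra.
  rewrite /rademacher big1 => [|l _]; last by rewrite a0; lra.
  by rewrite Rabs_R0 be Rmult_0_l; case: RltP => //; lra.
have bp : 0 < b by lra.
(* This parameter minimises [- th * b * t + th ^ 2 * b ^ 2 * V / 2]. *)
pose th := t / (b * V).
have th0 : 0 <= th.
  rewrite /th /Rdiv; apply: Rmult_le_pos => //; apply: Rlt_le.
  by apply: Rinv_0_lt_compat; apply: Rmult_lt_0_compat.
pose E := exp (- (t ^ 2 / V)).
(* One exponential for each sign of the sum dominates the indicator; [E] is
   [exp (- (th * (b * t)))]. *)
apply: (@Rle_trans _ (\rsum_(s : {ffun 'I_K -> bool})
  (E * exp (rademacher (fun l => th * a l) s)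
   + E * exp (rademacher (fun l => - th * a l) s)))).
  apply: rsum_le => s _; rewrite !rademacher_scale /E -!exp_plus.
  set X := rademacher a s.
  have e1 := exp_pos (- (t ^ 2 / V) + th * X).
  have e2 := exp_pos (- (t ^ 2 / V) + - th * X).
  case: RltP => H; rewrite /ind; last by lra.
  have Hth : th * (b * t) = t ^ 2 / V by rewrite /th /=; field; lra.
  have : 0 <= - (t ^ 2 / V) + th * Rabs X by rewrite -Hth; nra.
  rewrite /Rabs; case: Rcase_abs => _ Hx.
    have : 1 <= exp (- (t ^ 2 / V) + - th * X).
      by rewrite -exp_0; apply: exp_le; lra.
    by lra.
  have : 1 <= exp (- (t ^ 2 / V) + th * X).
    by rewrite -exp_0; apply: exp_le; lra.
  by lra.
rewrite rsumD !rsumZ.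
have M1 := rademacher_mgf (fun l => th * a l).
have M2 := rademacher_mgf (fun l => - th * a l).
have HS : forall z, z ^ 2 = th ^ 2 ->
    exp (\rsum_(l < K) (z * a l) ^ 2 / 2) <= exp (t ^ 2 / (2 * V)).
  move=> z Hz; apply: exp_le.
  have -> : \rsum_(l < K) (z * a l) ^ 2 / 2 = th ^ 2 / 2 * \rsum_(l < K) a l ^ 2.
    by rewrite -Hz big_distrr /=; apply: eq_bigr => l _; rewrite /=; field.
  apply: (@Rle_trans _ (th ^ 2 / 2 * (b ^ 2 * V))).
    by apply: Rmult_le_compat_l => //; have := pow2_ge_0 th; lra.
  by apply: Req_le; rewrite /th /=; field; lra.
have H1 := HS th erefl.
have H2 := HS (- th) ltac:(rewrite /=; ring).
have E0 : 0 < E by apply: exp_pos.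
have EE : E * exp (t ^ 2 / (2 * V)) = exp (- (t ^ 2 / (2 * V))).
  by rewrite /E -exp_plus; congr exp; rewrite /=; field; lra.
rewrite -EE.
have K1 : \rsum_(s : {ffun 'I_K -> bool}) exp (rademacher (fun l => th * a l) s)
   <= 2 ^ K * exp (t ^ 2 / (2 * V)).
  by apply: (Rle_trans _ _ _ M1); apply: Rmult_le_compat_l; lra.
have K2 : \rsum_(s : {ffun 'I_K -> bool}) exp (rademacher (fun l => - th * a l) s)
   <= 2 ^ K * exp (t ^ 2 / (2 * V)).
  by apply: (Rle_trans _ _ _ M2); apply: Rmult_le_compat_l; lra.
have L1 := Rmult_le_compat_l E _ _ (Rlt_le _ _ E0) K1.
have L2 := Rmult_le_compat_l E _ _ (Rlt_le _ _ E0) K2.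
by apply: (Rle_trans _ _ _ (Rplus_le_compat _ _ _ _ L1 L2)); lra.
Qed.

(** Flipping the sign at [l] permutes the patterns and negates the summand when [l != m], so the sum
    is its own negative. *)
Lemma rsum_sgn2 (K : nat) (l m : 'I_K) :
  \rsum_(s : {ffun 'I_K -> bool}) (sgn (s l) * sgn (s m))
  = if l == m then 2 ^ K else 0.
Proof.
case: eqP => [->|/eqP lm].
  rewrite (eq_bigr (fun=> 1)) => [|s _]; last by case: (s m) => /=; lra.
  by rewrite rsum_const card_ffun card_bool card_ord INR_exp2; lra.
pose fl (s : {ffun 'I_K -> bool}) := [ffun i => if i == l then ~~ s i else s i].
have flK : involutive fl.
  by move=> s; apply/ffunP => i; rewrite !ffunE; case: (i == l); rewrite ?negbK.
set S := \big[_/_]_s _.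
have : S = - 1 * S.
  rewrite {1}/S (reindex_inj (inv_inj flK)) big_distrr /=.
  apply: eq_bigr => s _; rewrite !ffunE eqxx (negbTE (_ : m != l)) 1?eq_sym //.
  by case: (s l); rewrite /=; lra.
by lra.
Qed.

Lemma rademacher_moment2 (K : nat) (a : 'I_K -> R) :
  \rsum_(s : {ffun 'I_K -> bool}) rademacher a s ^ 2
  = 2 ^ K * \rsum_(l < K) a l ^ 2.
Proof.
transitivity (\rsum_(s : {ffun 'I_K -> bool}) \rsum_(l < K) \rsum_(m < K)
   (a l * a m * (sgn (s l) * sgn (s m)))).
  apply: eq_bigr => s _; rewrite /rademacher /= Rmult_1_r big_distrl /=.
  by apply: eq_bigr => l _; rewrite big_distrr /=; apply: eq_bigr => m _; ring.
rewrite exchange_big big_distrr /=; apply: eq_bigr => l _.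
rewrite exchange_big /= (bigD1 l) //= [X in _ + X]big1 => [|m ml].
  by rewrite -big_distrr /= rsum_sgn2 eqxx; ring.
by rewrite -big_distrr /= rsum_sgn2 eq_sym (negbTE ml) Rmult_0_r.
Qed.

(** * Averages over permutations *)

(** Every permutation takes the value [o] at exactly one index. *)
Lemma perm_partition (K : nat) (o : 'I_K) (H : {perm 'I_K} -> R) :
  \rsum_(p : {perm 'I_K}) H p
  = \rsum_(i < K) \big[Rplus/0]_(p : {perm 'I_K} | p i == o) H p.
Proof.
rewrite (partition_big (fun p : {perm 'I_K} => (p^-1)%g o) predT) //=.
apply: eq_bigr => i _; apply: eq_bigl => p.
by apply/eqP/eqP => <-; rewrite ?permKV ?permK.
Qed.

(** Precomposition with the transposition of [i] and [j] matches the two corresponding classes of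
    [perm_partition], so all [K] classes have the same size. *)
Lemma rsum_perm_fix (K : nat) (o i : 'I_K) :
  INR K * \big[Rplus/0]_(p : {perm 'I_K} | p i == o) 1 = INR (K`!)%N.
Proof.
have E : \rsum_(p : {perm 'I_K}) 1 = INR (K`!)%N.
  by rewrite rsum_const Rmult_1_r -[in RHS]card_Sn.
rewrite -E (perm_partition o).
rewrite -[in INR K](card_ord K) -rsum_const; apply: eq_bigr => j _.
rewrite (reindex_inj (mulgI (tperm i j))) /=; apply: eq_bigl => p.
by rewrite permM tpermL.
Qed.

(* Permutations with [p i = o] spread the values [f (p l)], [l <> i], uniformly:
   precomposing with a transposition of [l] and [l'] swaps two of them. *)
Lemma rsum_perm_fix_avg (K : nat) (o i : 'I_K) (f g : 'I_K -> R) :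
  (1 < K)%N -> \rsum_(l < K) f l = 1 -> \rsum_(l < K) g l = 0 ->
  \big[Rplus/0]_(p : {perm 'I_K} | p i == o) (\rsum_(l < K) f (p l) * g l)
  = INR (K`!)%N / INR K * ((f o - (1 - f o) / (INR K - 1)) * g i).
Proof.
move=> K1 Hf Hg.
have K1' : 1 < INR K by apply: (lt_INR 1); apply/ltP.
set N := \big[Rplus/0]_(p : {perm 'I_K} | p i == o) 1.
have HN : INR (K`!)%N / INR K = N.
  by rewrite -(rsum_perm_fix o i) -/N; field; lra.
rewrite HN.
pose M l := \big[Rplus/0]_(p : {perm 'I_K} | p i == o) f (p l).
have Mi : M i = N * f o.
  rewrite /N /M Rmult_comm -rsumZ; apply: eq_bigr => p /eqP ->; ring.
have [j ji] : exists j, j != i.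
  have /card_gt0P [j] : (0 < #|predC1 i|)%N by rewrite cardC1 card_ord; case: (K) K1.
  by exists j.
have Mj l : l != i -> M l = M j.
  move=> li; rewrite /M (reindex_inj (mulgI (tperm l j))) /=; apply: eq_big => p.
    by rewrite permM tpermD // eq_sym.
  by move=> _; rewrite permM tpermL.
(* For each [p] the values [f (p l)] sum to 1, so the totals [M l] sum to [N]; this determines
   [M j]. *)
have HM : M i + (INR K - 1) * M j = N.
  transitivity (\rsum_(l < K) M l).
    rewrite (bigD1 i) //= (eq_bigr (fun=> M j)) // rsum_const.
    rewrite cardC1 card_ord -subn1 minus_INR //; exact/leP/ltnW.
  rewrite exchange_big /=; apply: eq_bigr => p _.
  rewrite -Hf [RHS](reindex_inj (@perm_inj _ p)); exact: eq_bigr.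
have Hgi : \big[Rplus/0]_(l < K | l != i) g l = - g i.
  have E : g i + \big[Rplus/0]_(l < K | l != i) g l = 0.
    by rewrite -[RHS]Hg [RHS](bigD1 i).
  by lra.
transitivity (\rsum_(l < K) M l * g l).
  rewrite exchange_big /=; apply: eq_bigr => l _.
  by rewrite /M big_distrl.
rewrite (bigD1 i) //= (eq_bigr (fun l => M j * g l)) => [|l li]; last by rewrite Mj.
rewrite rsumZ Hgi Mi.
have -> : M j = (N - N * f o) / (INR K - 1).
  have -> : N - N * f o = (INR K - 1) * M j by rewrite Mi in HM; lra.
  by field; lra.
by field; lra.
Qed.

(** * Numerical comparison of the tail with the gain *)

(** The 16th power of [1 - x <= exp (- x)] at [x = 65 / 800], a sixteenth of 13/10, gives
    [exp (- (13 / 10)) > / 4]. *)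
Lemma ln4_gt : 13 / 10 < ln 4.
Proof.
have H : 1 - 65 / 800 <= exp (- (65 / 800)) by have := exp_ineq1_le (- (65 / 800)); lra.
have H2 : (1 - 65 / 800) ^ 16 <= exp (- (65 / 800)) ^ 16 by apply: pow_incr; lra.
have E : exp (- (65 / 800)) ^ 16 = exp (- (13 / 10)).
  rewrite -(exp_ln (exp (- (65 / 800)) ^ 16)); last by apply: pow_lt; apply: exp_pos.
  congr exp; rewrite ln_pow; last exact: exp_pos.
  by rewrite ln_exp /=; lra.
rewrite -{1}(ln_exp (13 / 10)); apply: ln_increasing; first exact: exp_pos.
have H3 : / 4 < exp (- (13 / 10)) by rewrite -E; apply: Rlt_le_trans H2; lra.
rewrite exp_Ropp in H3.
have := exp_pos (13 / 10) => H4.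
have := Rinv_lt_contravar (/ 4) _ _ H3; rewrite !Rinv_inv; apply.
by apply: Rmult_lt_0_compat; [lra|apply: Rinv_0_lt_compat].
Qed.

(** Multiply [v / 2 <= exp (v / 2 - 1)] by [2 <= exp (3 / 4)]; the latter comes from the 8th power
    of [1 + x <= exp x] at [x = 75 / 800]. *)
Lemma le_exp_half (v : R) : v <= exp (v / 2 - / 4).
Proof.
have H : 1 + 75 / 800 <= exp (75 / 800) by apply: exp_ineq1_le.
have H2 : (1 + 75 / 800) ^ 8 <= exp (75 / 800) ^ 8 by apply: pow_incr; lra.
have E : exp (75 / 800) ^ 8 = exp (3 / 4).
  rewrite -(exp_ln (exp (75 / 800) ^ 8)); last by apply: pow_lt; apply: exp_pos.
  congr exp; rewrite ln_pow; last exact: exp_pos.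
  by rewrite ln_exp /=; lra.
have H3 : 2 <= exp (3 / 4) by rewrite -E; apply: Rle_trans H2; lra.
have H4 := exp_ineq1_le (v / 2 - 1).
have -> : v / 2 - / 4 = 3 / 4 + (v / 2 - 1) by lra.
rewrite exp_plus; have := exp_pos (v / 2 - 1) => H5.
by apply: (Rle_trans _ (2 * exp (v / 2 - 1))); nra.
Qed.

(* The constants come from [L >= 13/10] and [eps < 1/5]: they give
   [t^2 >= (94/100) del^2], and then [v = 1 / sqrt w >= 5] reduces the claim to
   [(94/100) L v > L + 2 ln v], which follows from [2 ln v <= v - 1/2]. *)
Lemma tail_beats_gain (A L eps w del : R) :
  1 <= A -> 13 / 10 <= L -> 0 < eps -> eps < / 5 -> 0 < del ->
  2 * A * L * eps <= del ^ 2 -> 0 < w -> w <= eps ^ 2 ->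
  0 <= del - eps ^ 2 / 2 /\
  exp (- ((del - eps ^ 2 / 2) ^ 2 / (2 * (A * w)))) < exp (- L) * w.
Proof.
move=> A1 L1 e0 e5 d0 Hd w0 we.
have AL : 13 / 10 <= A * L by nra.
have D1 : 26 / 10 * eps <= del ^ 2.
  apply: Rle_trans Hd; have -> : 2 * A * L * eps = 2 * (A * L) * eps by ring.
  by apply: Rmult_le_compat_r; lra.
(* Compare squares: [eps ^ 4 / 4 <= eps / 500], whereas [9 / 10000 * del ^ 2] is at least
   [234 / 100000 * eps]. *)
have D2 : eps ^ 2 / 2 <= 3 / 100 * del.
  apply: Rsqr_incr_0_var; last by lra.
  have e4 : eps ^ 2 * eps <= / 125.
    have : eps ^ 2 <= / 25 by rewrite /=; nra.
    by have := pow2_ge_0 eps; nra.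
  have : eps ^ 2 * eps * eps <= / 125 * eps by apply: Rmult_le_compat_r; lra.
  have -> : Rsqr (3 / 100 * del) = 9 / 10000 * del ^ 2 by rewrite /Rsqr /=; field.
  have -> : Rsqr (eps ^ 2 / 2) = eps ^ 2 * eps * eps / 4 by rewrite /Rsqr /=; field.
  by lra.
split; first by lra.
set t := del - eps ^ 2 / 2.
have T2 : 94 / 100 * del ^ 2 <= t ^ 2.
  have Ht : 97 / 100 * del <= t by rewrite /t; lra.
  by rewrite /=; nra.
pose r := sqrt w.
have rr : r * r = w by apply: sqrt_sqrt; lra.
have r0 : 0 < r by apply: sqrt_lt_R0.
have re : r <= eps.
  apply: Rsqr_incr_0_var; last by lra.
  by rewrite /Rsqr rr; move: we; rewrite /=; lra.
pose v := / r.
have vr : v * r = 1 by rewrite /v; field; lra.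
have v5 : 5 <= v by nra.
(* Inverting and squaring [v <= exp (v / 2 - / 4)] replaces the factor [w] by an exponential. *)
have W : exp (- (v - / 2)) <= w.
  have Hv := le_exp_half v.
  have -> : - (v - / 2) = - (v / 2 - / 4) + - (v / 2 - / 4) by lra.
  rewrite exp_plus exp_Ropp -rr.
  have Hi : / exp (v / 2 - / 4) <= r.
    rewrite -[r]Rinv_inv -/v; apply: Rinv_le_contravar => //.
    by lra.
  have := Rinv_0_lt_compat _ (exp_pos (v / 2 - / 4)).
  by move=> Hp; apply: Rmult_le_compat; lra.
apply: (Rlt_le_trans _ (exp (- L) * exp (- (v - / 2)))); last first.
  by apply: Rmult_le_compat_l => //; apply: Rlt_le; apply: exp_pos.
rewrite -exp_plus; apply: exp_increasing.
(* Since [r <= eps], [del ^ 2 >= 2 * A * L * r]; dividing by [2 * A * w] with [w = r * r] leaves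
   [L * v]. *)
have : 94 / 100 * (L * v) <= t ^ 2 / (2 * (A * w)).
  apply: (Rmult_le_reg_r (2 * (A * w))).
    by apply: Rmult_lt_0_compat; [lra|apply: Rmult_lt_0_compat; lra].
  have -> : t ^ 2 / (2 * (A * w)) * (2 * (A * w)) = t ^ 2 by field; lra.
  apply: Rle_trans T2.
  have -> : 94 / 100 * (L * v) * (2 * (A * w))
          = 94 / 100 * (2 * A * L * r * (v * r)) by rewrite -rr; ring.
  rewrite vr Rmult_1_r; apply: Rmult_le_compat_l; first by lra.
  apply: Rle_trans Hd; apply: Rmult_le_compat_l => //.
  by rewrite Rmult_assoc; lra.
(* For [v >= 5] the bracket is positive, so [L] may be lowered to 13/10; the remaining inequality is
   linear in [v]. *)
have : 13 / 10 * (94 / 100 * v - 1) <= L * (94 / 100 * v - 1).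
  by apply: Rmult_le_compat_r; lra.
by lra.
Qed.

(** * Maxima, inner products and frames *)

Lemma foldr_Rmax_ge (T : eqType) (f : T -> R) (r : seq T) (x : T) :
  x \in r -> f x <= foldr Rmax 0 [seq f i | i <- r].
Proof.
elim: r => //= y r IH; rewrite inE => /orP [/eqP ->|/IH H]; first exact: Rmax_l.
by apply: Rle_trans H _; apply: Rmax_r.
Qed.

Lemma foldr_Rmax_ge0 (T : Type) (f : T -> R) (r : seq T) :
  0 <= foldr Rmax 0 [seq f i | i <- r].
Proof.
by elim: r => [|y r IH] /=; [lra|apply: Rle_trans IH _; apply: Rmax_r].
Qed.

(** The fold starts at 0, whence the condition [0 <= B]. *)
Lemma foldr_Rmax_le (T : Type) (f : T -> R) (r : seq T) (B : R) :
  0 <= B -> (forall x, f x <= B) -> foldr Rmax 0 [seq f i | i <- r] <= B.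
Proof. by move=> B0 HB; elim: r => [|y r IH] //=; apply: Rmax_lub. Qed.

Lemma linf_sqr_ge (n : nat) (v : 'I_n -> R) (i : 'I_n) : v i ^ 2 <= linf v ^ 2.
Proof.
rewrite -(pow2_abs (v i)); apply: pow_incr; split; first exact: Rabs_pos.
by apply: (@foldr_Rmax_ge _ (fun i => Rabs (v i))); rewrite mem_enum.
Qed.

Lemma linf_sqr_le (n : nat) (v : 'I_n -> R) (B : R) :
  0 <= B -> (forall i, v i ^ 2 <= B) -> linf v ^ 2 <= B.
Proof.
move=> B0 HB; rewrite -(pow2_sqrt B B0); apply: pow_incr; split.
  exact: foldr_Rmax_ge0.
apply: foldr_Rmax_le; first exact: sqrt_pos.
by move=> i; rewrite -sqrt_Rsqr_abs Rsqr_pow2; apply: sqrt_le_1_alt.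
Qed.

Lemma dotC (d : nat) (u v : 'I_d -> R) : dot u v = dot v u.
Proof. by apply: eq_bigr => j _; rewrite Rmult_comm. Qed.

Lemma dot_linear_l (d : nat) (a b : R) (u v w : 'I_d -> R) :
  dot (fun j => a * u j + b * v j) w = a * dot u w + b * dot v w.
Proof.
by rewrite /dot -!rsumZ -rsumD; apply: eq_bigr => j _; ring.
Qed.

Lemma dot_quadratic (d : nat) (a b : R) (u v : 'I_d -> R) :
  dot (fun j => a * u j + b * v j) (fun j => a * u j + b * v j)
  = a ^ 2 * dot u u + 2 * a * b * dot u v + b ^ 2 * dot v v.
Proof.
rewrite dot_linear_l ![dot _ (fun j => a * _ + _)]dotC !dot_linear_l (dotC v u).
by rewrite /=; ring.
Qed.

Lemma dot_self_ge0 (d : nat) (u : 'I_d -> R) : 0 <= dot u u.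
Proof. by apply: rsum_ge0 => j _; apply: Rle_0_sqr. Qed.

Lemma dot_cauchy (d : nat) (u v : 'I_d -> R) : dot u v ^ 2 <= dot u u * dot v v.
Proof.
have E (w : 'I_d -> R) : dot w w = \rsum_(j < d) w j ^ 2.
  by apply: eq_bigr => j _; rewrite /=; ring.
by rewrite !E; apply: rsum_cauchy.
Qed.

Lemma dot_unit (d : nat) (u : 'I_d -> R) : norm2 u = 1 -> dot u u = 1.
Proof. by move=> H; rewrite -(sqrt_sqrt _ (dot_self_ge0 u)) -/(norm2 u) H; ring. Qed.

Lemma dot_synthesis (d K : nat) (Phi : dict d K) (x : 'I_K -> R) (v : 'I_d -> R) :
  dot v (synthesis Phi x) = \rsum_(l < K) x l * dot v (Phi l).
Proof.
transitivity (\rsum_(j < d) \rsum_(l < K) (x l * (v j * Phi l j))).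
  by apply: eq_bigr => j _; rewrite /synthesis -rsumZ; apply: eq_bigr => l _; ring.
by rewrite exchange_big /=; apply: eq_bigr => l _; rewrite rsumZ.
Qed.

Lemma dot_synthesis_cps (d K : nat) (Phi : dict d K) (c : nat -> R) p s v :
  dot v (synthesis Phi (@cps K c p s)) = rademacher (fun l => c (p l) * dot v (Phi l)) s.
Proof. by rewrite dot_synthesis; apply: eq_bigr => l _; rewrite /cps; ring. Qed.

(** Duality: |y|^2 is the sum of [x l] times <phi_l, y>, so Cauchy-Schwarz and the frame identity
    give |y|^4 <= |x|^2 A |y|^2. *)
Lemma untf_synthesis_le (d K : nat) (Phi : dict d K) (A : R) (x : 'I_K -> R) :
  is_untf Phi A -> 0 <= A ->
  dot (synthesis Phi x) (synthesis Phi x) <= A * \rsum_(l < K) x l ^ 2.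
Proof.
case=> _ HA A0; set y := synthesis Phi x; set X := \rsum_(l < K) _.
have X0 : 0 <= X by apply: rsum_ge0 => l _; apply: pow2_ge_0.
have E : dot y y = \rsum_(l < K) x l * dot (Phi l) y.
  by rewrite [LHS]dot_synthesis; apply: eq_bigr => l _; rewrite dotC.
have H : dot y y ^ 2 <= X * (A * dot y y).
  by rewrite -HA {1}E; apply: rsum_cauchy.
case: (dot_self_ge0 y) => [yp|<-]; last exact: Rmult_le_pos.
apply: (Rmult_le_reg_l (dot y y)) => //; move: H; rewrite /=; lra.
Qed.

(** In the frame identity at [v = Phi i], the term of index [i] is already 1. *)
Lemma untf_const_ge1 (d K : nat) (Phi : dict d K) (A : R) (i : 'I_K) :
  is_untf Phi A -> 1 <= A.
Proof.
case=> HD HA; have E := dot_unit (HD i).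
have := HA (Phi i); rewrite E Rmult_1_r => <-.
apply: Rle_trans (@rsum_term_le _ (fun l => dot (Phi l) (Phi i) ^ 2) i _).
  by rewrite E /=; lra.
by move=> l; apply: pow2_ge_0.
Qed.

Lemma coherence_ge (d K : nat) (Phi : dict d K) (i j : 'I_K) :
  i != j -> Rabs (dot (Phi i) (Phi j)) <= coherence Phi.
Proof.
move=> ij; apply: (@foldr_Rmax_ge _
  (fun ij : 'I_K * 'I_K => Rabs (dot (Phi ij.1) (Phi ij.2))) _ (i, j)).
by rewrite mem_enum.
Qed.

Lemma coherence_ge0 (d K : nat) (Phi : dict d K) : 0 <= coherence Phi.
Proof. exact: foldr_Rmax_ge0. Qed.

Lemma dict_dist_ge (d K : nat) (Psi Phi : dict d K) (i : 'I_K) :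
  norm2 (fun j => Psi i j - Phi i j) <= dict_dist Psi Phi.
Proof.
by apply: (@foldr_Rmax_ge _ (fun i => norm2 (fun j => Psi i j - Phi i j)));
  rewrite mem_enum.
Qed.

Lemma dict_dist_eq0 (d K : nat) (Psi Phi : dict d K) :
  (forall i, norm2 (fun j => Psi i j - Phi i j) <= 0) -> dict_dist Psi Phi = 0.
Proof.
move=> H; apply: Rle_antisym; last exact: foldr_Rmax_ge0.
by apply: foldr_Rmax_le => //; lra.
Qed.

(** * Perturbed atoms and their residuals *)

Lemma dot_near (d : nat) (u v : 'I_d -> R) :
  norm2 u = 1 -> norm2 v = 1 ->
  dot u v = 1 - norm2 (fun j => u j - v j) ^ 2 / 2.
Proof.
move=> /dot_unit Hu /dot_unit Hv; rewrite /norm2 pow2_sqrt; last exact: dot_self_ge0.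
have -> : (fun j => u j - v j) = (fun j => 1 * u j + (-1) * v j).
  by apply: functional_extensionality => j; ring.
by rewrite dot_quadratic Hu Hv /=; field.
Qed.

(* [<r_j, phi_l>] for the component [r_j] of [psi_j] orthogonal to [phi_j]. *)
Definition resid (d K : nat) (Psi Phi : dict d K) (j l : 'I_K) : R :=
  dot (Psi j) (Phi l) - dot (Psi j) (Phi j) * dot (Phi j) (Phi l).

Lemma resid_diag (d K : nat) (Psi Phi : dict d K) (j : 'I_K) :
  in_D Phi -> resid Psi Phi j j = 0.
Proof. by move=> HD; rewrite /resid (dot_unit (HD j)); ring. Qed.

(** The frame identity at r_j = psi_j - alpha_j phi_j, whose squared norm is 1 - alpha_j^2. *)
Lemma resid_energy (d K : nat) (Psi Phi : dict d K) (A : R) (j : 'I_K) :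
  is_untf Phi A -> in_D Psi ->
  \rsum_(l < K) resid Psi Phi j l ^ 2 = A * (1 - dot (Psi j) (Phi j) ^ 2).
Proof.
case=> HD HA HPsi; set al := dot (Psi j) (Phi j).
have := HA (fun k => 1 * Psi j k + (- al) * Phi j k).
rewrite dot_quadratic (dot_unit (HD j)) (dot_unit (HPsi j)) -/al => E.
transitivity (A * (1 ^ 2 * 1 + 2 * 1 * - al * al + (- al) ^ 2 * 1)); last by rewrite /=; ring.
rewrite -E; apply: eq_bigr => l _; rewrite (dotC (Phi l)) dot_linear_l /resid -/al.
by rewrite /=; ring.
Qed.

(** The term [l = j] is the subtracted one because phi_j is a unit vector. Each other term is at
    most the coherence times its coefficient; adding the missing index back makes the bound
    independent of [p] and [j]. *)
Lemma frame_coherence_bound (d K : nat) (Phi : dict d K) (c : nat -> R) p s (j : 'I_K) :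
  in_D Phi ->
  Rabs (dot (Phi j) (synthesis Phi (@cps K c p s)) - sgn (s j) * c (p j))
  <= coherence Phi * \rsum_(l < K) Rabs (c l).
Proof.
move=> HD; rewrite dot_synthesis.
set T := \big[Rplus/0]_(l < K | l != j) (cps c p s l * dot (Phi j) (Phi l)).
have -> : \rsum_(l < K) cps c p s l * dot (Phi j) (Phi l) = sgn (s j) * c (p j) + T.
  by rewrite (bigD1 j) //= (dot_unit (HD j)) Rmult_1_r.
rewrite (_ : sgn (s j) * c (p j) + T - sgn (s j) * c (p j) = T); last by ring.
apply: Rle_trans (rsum_abs _ _ _) _.
rewrite [X in _ <= _ * X](reindex_inj (@perm_inj _ p)) -rsumZ /= [X in _ <= X](bigD1 j) //=.
rewrite -[X in X <= _]Rplus_0_l; apply: Rplus_le_compat.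
  by apply: Rmult_le_pos; [exact: coherence_ge0|exact: Rabs_pos].
apply: rsum_le => l lj; rewrite Rabs_mult Rmult_comm.
apply: Rmult_le_compat; try exact: Rabs_pos.
  by apply: coherence_ge; rewrite eq_sym.
rewrite /cps Rabs_mult; case: (s l) => /=; rewrite ?Rabs_Ropp Rabs_R1; lra.
Qed.

Lemma dot_resid_split (d K : nat) (Psi Phi : dict d K) (c : nat -> R) p s (j : 'I_K) :
  dot (Psi j) (synthesis Phi (@cps K c p s))
  = dot (Psi j) (Phi j) * dot (Phi j) (synthesis Phi (cps c p s))
    + rademacher (fun l => c (p l) * resid Psi Phi j l) s.
Proof.
rewrite !dot_synthesis_cps -rademacher_scale /rademacher -rsumD.
by apply: eq_bigr => l _; rewrite /resid; ring.
Qed.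

(** * The leading atom when the noise is small *)

Lemma Rabs_sgn_mult (b : bool) (x : R) : Rabs (sgn b * x) = Rabs x.
Proof. by rewrite Rabs_mult; case: b => /=; rewrite ?Rabs_Ropp Rabs_R1; ring. Qed.

(** By [dot_resid_split], |<psi_j, y>| <= c_2 + m + c_1 t for [j != i], and |<psi_i, y>| >= beta
    (c_1 - m) - c_2 t; the last hypothesis compares these two bounds. *)
Lemma leading_atom_dominates (d K : nat) (Psi Phi : dict d K) (c : nat -> R)
    (p : {perm 'I_K}) s (i j : 'I_K) (beta t : R) :
  let m := coherence Phi * \rsum_(l < K) Rabs (c l) in
  in_D Phi -> c (p i) = c 0%N ->
  (forall l : 'I_K, 0 <= c (p l)) ->
  (forall l : 'I_K, l != i -> c (p l) <= c 1%N) ->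
  (forall l : 'I_K, beta <= dot (Psi l) (Phi l) <= 1) -> 0 <= beta ->
  m <= c 0%N ->
  (forall l : 'I_K, Rabs (rademacher (fun k => c (p k) * resid Psi Phi l k) s)
      <= (if l == i then c 1%N else c 0%N) * t) ->
  (c 1%N + c 0%N) * t <= beta * (c 0%N - m) - (c 1%N + m) ->
  dot (Psi j) (synthesis Phi (@cps K c p s)) ^ 2
  <= dot (Psi i) (synthesis Phi (cps c p s)) ^ 2.
Proof.
move=> m HD pi c_ge0 c_le1 Hal b0 mc0 Hn Ht.
have m0 : 0 <= m.
  by apply: Rmult_le_pos; [exact: coherence_ge0|apply: rsum_ge0 => l _; exact: Rabs_pos].
case: (eqVneq j i) => [->|ji]; first by lra.
have Habs (x y : R) : Rabs x <= Rabs y -> x ^ 2 <= y ^ 2.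
  move=> H; rewrite -(pow2_abs x) -(pow2_abs y).
  by apply: pow_incr; split => //; apply: Rabs_pos.
apply: Habs; rewrite (dot_resid_split Psi Phi c p s i) (dot_resid_split Psi Phi c p s j).
have Hi := Hn i; have Hj := Hn j; rewrite eqxx in Hi; rewrite (negbTE ji) in Hj.
have [ai1 ai2] := Hal i; have [aj1 aj2] := Hal j.
set ri := rademacher _ s in Hi *; set rj := rademacher _ s in Hj *.
set ai := dot (Psi i) (Phi i) in ai1 ai2 *; set aj := dot (Psi j) (Phi j) in aj1 aj2 *.
have := frame_coherence_bound c p s i HD; have := frame_coherence_bound c p s j HD.
rewrite -/m; set qi := dot (Phi i) _; set qj := dot (Phi j) _ => Bj Bi.
have Qj : Rabs qj <= c 1%N + m.
  have := Rabs_triang (qj - sgn (s j) * c (p j)) (sgn (s j) * c (p j)).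
  rewrite Rabs_sgn_mult (Rabs_pos_eq (c (p j))) //.
  have -> : qj - sgn (s j) * c (p j) + sgn (s j) * c (p j) = qj by ring.
  by have := c_le1 j ji; lra.
have Qi : c 0%N - m <= Rabs qi.
  have := Rabs_triang_inv (sgn (s i) * c (p i)) qi.
  rewrite Rabs_sgn_mult (Rabs_pos_eq (c (p i))) // pi.
  by rewrite Rabs_minus_sym; move: Bi; rewrite pi; lra.
have Uj : Rabs (aj * qj + rj) <= (c 1%N + m) + c 0%N * t.
  have := Rabs_triang (aj * qj) rj; rewrite Rabs_mult (Rabs_pos_eq aj); last by lra.
  have : aj * Rabs qj <= 1 * Rabs qj by apply: Rmult_le_compat_r => //; exact: Rabs_pos.
  by lra.
have Ui : beta * (c 0%N - m) - c 1%N * t <= Rabs (ai * qi + ri).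
  have := Rabs_triang_inv (ai * qi) (- ri).
  rewrite Rabs_mult (Rabs_pos_eq ai); last by lra.
  rewrite Rabs_Ropp /Rminus Ropp_involutive.
  have : beta * (c 0%N - m) <= ai * Rabs qi by apply: Rmult_le_compat; lra.
  by rewrite /Rminus; lra.
by lra.
Qed.

(** For [j = i] the term [l = i], the only one that carries c_1, is killed by [resid_diag], so c_2
    bounds the other coefficients. *)
Lemma noise_energy_le (d K : nat) (Psi Phi : dict d K) (A : R) (c : nat -> R)
    (p : {perm 'I_K}) (i j : 'I_K) :
  is_untf Phi A -> in_D Psi ->
  (forall l : 'I_K, 0 <= c (p l) <= c 0%N) ->
  (forall l : 'I_K, l != i -> c (p l) <= c 1%N) ->
  \rsum_(l < K) (c (p l) * resid Psi Phi j l) ^ 2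
  <= (if j == i then c 1%N else c 0%N) ^ 2 * (A * (1 - dot (Psi j) (Phi j) ^ 2)).
Proof.
move=> HF HPsi c_le0 c_le1; rewrite -(resid_energy j HF HPsi) -rsumZ.
apply: rsum_le => l _; rewrite Rpow_mult_distr.
have [l0 l1] := c_le0 l; have r0 := pow2_ge_0 (resid Psi Phi j l).
case: eqP => [ji|_]; last by apply: Rmult_le_compat_r => //; apply: pow_incr.
case: (eqVneq l i) => [li|li]; first by rewrite li ji (resid_diag _ _ (proj1 HF)) /=; lra.
by apply: Rmult_le_compat_r => //; apply: pow_incr; split => //; exact: c_le1.
Qed.

(** * Strict decrease of the objective *)

Lemma objective_lt (d K : nat) (Phi Psi : dict d K) (A : R) (c : nat -> R) (eps : R) :
  let m := coherence Phi * \rsum_(l < K) Rabs (c l) in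
  let del := (c 0%N - c 1%N - 2 * m) / (c 1%N + c 0%N) in
  let lam := c 0%N ^ 2 - (1 - c 0%N ^ 2) / (INR K - 1) in
  (1 < K)%N -> is_untf Phi A ->
  (forall i j : nat, (i <= j)%N -> (j < K)%N -> c j <= c i) ->
  (forall i : nat, (i < K)%N -> 0 <= c i) ->
  \rsum_(i < K) c i ^ 2 = 1 ->
  0 < del -> 0 < lam <= 1 ->
  eps < / 5 -> 2 * A * ln (2 * A * INR K / lam) * eps <= del ^ 2 ->
  in_D Psi -> 0 < dict_dist Psi Phi -> dict_dist Psi Phi <= eps ->
  objective Phi c Psi < objective Phi c Phi.
Proof.
move=> m del lam K1 HF c_sorted c_nonneg c_norm del0 [lam0 lam1] e5 Hdel HPsi dist0 dist_eps.
have K0 : (0 < K)%N := ltnW K1.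
pose o : 'I_K := Ordinal K0.
have A1 := untf_const_ge1 o HF.
have K1' : 2 <= INR K by apply: (le_INR 2); apply/leP.
have P2 : 0 < 2 ^ K by apply: pow_lt; lra.
set L := ln _ in Hdel.
(* From [A >= 1], [K >= 2] and [lam <= 1]; hence [L >= ln 4]. *)
have AK : 4 <= 2 * A * INR K / lam.
  apply: (Rmult_le_reg_r lam) => //.
  have -> : 2 * A * INR K / lam * lam = 2 * A * INR K by field; lra.
  by nra.
have L1 : 13 / 10 <= L.
  apply: Rlt_le; apply: Rlt_le_trans ln4_gt _; rewrite /L.
  by case: AK => [H|<-]; [apply: Rlt_le; apply: ln_increasing; lra|apply: Rle_refl].
have expL : exp (- L) = lam / (2 * A * INR K).
  by rewrite exp_Ropp exp_ln; [field; lra|lra].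
have c1c0 : c 1%N <= c 0%N by apply: c_sorted.
have c1_ge0 := c_nonneg 1%N K1; have c0_ge0 := c_nonneg 0%N K0.
(* A zero denominator would make [del] equal to 0, because [/ 0] is 0. *)
have c01 : 0 < c 1%N + c 0%N.
  case: (Rle_lt_dec (c 1%N + c 0%N) 0) => // H.
  suff : del = 0 by lra.
  by rewrite /del; have -> : c 1%N + c 0%N = 0 by [lra]; rewrite /Rdiv Rinv_0 Rmult_0_r.
have delE : del * (c 1%N + c 0%N) = c 0%N - c 1%N - 2 * m by rewrite /del; field; lra.
have m0 : 0 <= m.
  by apply: Rmult_le_pos; [exact: coherence_ge0|apply: rsum_ge0 => l _; exact: Rabs_pos].
pose t := del - eps ^ 2 / 2.
pose al j := dot (Psi j) (Phi j); pose w j := 1 - al j ^ 2.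
pose e j := norm2 (fun k => Psi j k - Phi j k).
have alE j : al j = 1 - e j ^ 2 / 2 by apply: dot_near; [exact: HPsi|exact: (proj1 HF)].
have e_ge0 j : 0 <= e j by apply: sqrt_pos.
have e_le j : e j <= eps by apply: Rle_trans (dict_dist_ge _ _ _) dist_eps.
have e0 : 0 < eps by lra.
have e2 j : e j ^ 2 <= eps ^ 2 by apply: pow_incr.
have eps2 : eps ^ 2 <= / 25 by rewrite /=; nra.
have al_bd j : 1 - eps ^ 2 / 2 <= al j <= 1.
  by rewrite alE; have := e2 j; have := pow2_ge_0 (e j); lra.
have w_ge0 j : 0 <= w j by rewrite /w /=; have := al_bd j; nra.
have w_le j : w j <= eps ^ 2.
  rewrite /w alE.
  have -> : 1 - (1 - e j ^ 2 / 2) ^ 2 = e j ^ 2 - (e j ^ 2) ^ 2 / 4 by rewrite /=; field.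
  by have := e2 j; have := pow2_ge_0 (e j ^ 2); lra.
have [j0 wj0] : exists j, 0 < w j.
  have [j ej] : exists j, 0 < e j.
    apply: NNPP => H; suff : dict_dist Psi Phi = 0 by lra.
    apply: dict_dist_eq0 => j; apply: Rnot_lt_le => ej; apply: H; exists j; exact: ej.
  exists j; rewrite /w alE.
  have -> : 1 - (1 - e j ^ 2 / 2) ^ 2 = e j ^ 2 * (1 - e j ^ 2 / 4) by rewrite /=; field.
  apply: Rmult_lt_0_compat; first exact: pow_lt.
  by have := e2 j; lra.
have t_ge0 : 0 <= t.
  exact: (proj1 (tail_beats_gain A1 L1 e0 e5 del0 Hdel wj0 (w_le j0))).
(* This is [2 * exp (- L)], the bound on the exceptional probability per unit of [w j]. *)
pose G := lam / (A * INR K).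
have c_ge0 (p : {perm 'I_K}) (l : 'I_K) : 0 <= c (p l) <= c 0%N.
  by split; [exact: c_nonneg|apply: c_sorted].
(* By injectivity [p l] is not [o], so its 0-based value is at least 1. *)
have c_le1 (p : {perm 'I_K}) (i l : 'I_K) : p i = o -> l != i -> c (p l) <= c 1%N.
  move=> pi li; apply: c_sorted => //; rewrite lt0n; apply: contra li => /eqP pl.
  by apply/eqP; apply: (@perm_inj _ p); rewrite pi; apply: val_inj.
pose noisy (p : {perm 'I_K}) (i j : 'I_K) (s : {ffun 'I_K -> bool}) : R :=
  ind (Rltb ((if j == i then c 1%N else c 0%N) * t)
        (Rabs (rademacher (fun l => c (p l) * resid Psi Phi j l) s))).
(* Strictness is claimed only for atoms with [w j > 0]; if [w j = 0], the noise of atom [j] is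
   identically zero and the event is empty. *)
have noisy_le (p : {perm 'I_K}) (i j : 'I_K) : p i = o ->
    \rsum_(s : {ffun 'I_K -> bool}) noisy p i j s <= 2 ^ K * (G * w j)
    /\ (0 < w j -> \rsum_(s : {ffun 'I_K -> bool}) noisy p i j s < 2 ^ K * (G * w j)).
  move=> pi.
  have HE := @noise_energy_le _ _ Psi Phi A c p i j HF HPsi (c_ge0 p)
    (fun l => c_le1 p i l pi).
  rewrite -/(al j) -/(w j) in HE.
  have b0 : 0 <= (if j == i then c 1%N else c 0%N) by case: ifP.
  have strict : 0 < w j ->
      \rsum_(s : {ffun 'I_K -> bool}) noisy p i j s < 2 ^ K * (G * w j).
    move=> wj.
    apply: Rle_lt_trans (rademacher_tail (V := A * w j) _ t_ge0 b0 HE) _.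
      by apply: Rmult_lt_0_compat; lra.
    apply: Rmult_lt_compat_l => //.
    have := proj2 (tail_beats_gain A1 L1 e0 e5 del0 Hdel wj (w_le j)).
    rewrite -/t expL => H.
    have -> : G * w j = 2 * (lam / (2 * A * INR K) * w j) by rewrite /G; field; lra.
    by lra.
  split => //; case: (w_ge0 j) => [wj|wj]; first by apply: Rlt_le; apply: strict.
  rewrite -wj !Rmult_0_r; apply: Req_le; apply: big1 => s _.
  have a0 : forall l, c (p l) * resid Psi Phi j l = 0.
    by apply: rsum_sqr_eq0; move: HE; rewrite -wj !Rmult_0_r.
  rewrite /noisy /rademacher big1 => [|l _]; last by rewrite a0 Rmult_0_r.
  rewrite Rabs_R0; case: RltP => // H.
  by have := Rmult_le_pos _ _ b0 t_ge0; lra.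
(* If some atom is noisy, the indicators sum to at least 1, and |<psi_j, y>|^2 <= |y|^2 <= A pays
   for the loss; otherwise atom [i] attains the maximum. *)
have upper (p : {perm 'I_K}) (i : 'I_K) s : p i = o ->
    linf (analysis Psi (synthesis Phi (cps c p s))) ^ 2
    <= dot (Psi i) (synthesis Phi (cps c p s)) ^ 2
       + A * \rsum_(j < K) noisy p i j s.
  move=> pi; set y := synthesis _ _.
  have n0 j : 0 <= noisy p i j s by rewrite /noisy; case: RltP => _ /=; lra.
  have N0 : 0 <= \rsum_(j < K) noisy p i j s by apply: rsum_ge0.
  have q0 := pow2_ge_0 (dot (Psi i) y).
  have AN : 0 <= A * \rsum_(j < K) noisy p i j s by apply: Rmult_le_pos; lra.
  apply: linf_sqr_le; first by lra.
  move=> j; rewrite /analysis.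
  case: (classic (exists k, noisy p i k s = 1)) => [[k nk]|Hgood].
    have : 1 <= \rsum_(j < K) noisy p i j s.
      by rewrite -{1}nk; exact: (@rsum_term_le _ (fun j => noisy p i j s)).
    have yA : dot y y <= A.
      apply: Rle_trans (untf_synthesis_le _ HF _) _; first by lra.
      have -> : \rsum_(l < K) cps c p s l ^ 2 = 1.
        rewrite -[RHS]c_norm [RHS](reindex_inj (@perm_inj _ p)); apply: eq_bigr => l _.
        by rewrite /cps; case: (s l); rewrite /=; ring.
      by lra.
    have := dot_cauchy (Psi j) y; rewrite (dot_unit (HPsi j)) Rmult_1_l.
    by move=> *; nra.
  suff : dot (Psi j) y ^ 2 <= dot (Psi i) y ^ 2 by lra.
  apply: (@leading_atom_dominates _ _ Psi Phi c p s i j (1 - eps ^ 2 / 2) t).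
  - exact: (proj1 HF).
  - by rewrite pi.
  - by move=> l; case: (c_ge0 p l).
  - by move=> l; apply: c_le1.
  - exact: al_bd.
  - by lra.
  - rewrite -/m; have := Rmult_lt_0_compat _ _ del0 c01; rewrite delE; lra.
  - move=> l; apply: Rnot_lt_le => H; apply: Hgood; exists l.
    by rewrite /noisy; case: RltP.
  (* With [beta = 1 - eps ^ 2 / 2] the terms free of [eps] cancel by [delE], and
     [c_1 - m <= c_1 + c_2] settles the rest. *)
  - rewrite -/m /t; have := pow2_ge_0 eps => E2.
    have : eps ^ 2 / 2 * (c 0%N - m) <= eps ^ 2 / 2 * (c 1%N + c 0%N).
      by apply: Rmult_le_compat_l; lra.
    by lra.
(* By [rademacher_moment2], the mean over the signs of <D_i, y>^2. *)
pose q (D : dict d K) (p : {perm 'I_K}) (i : 'I_K) :=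
  \rsum_(l < K) (c (p l) * dot (D i) (Phi l)) ^ 2.
pose W := \rsum_(j < K) w j.
pose obj (D : dict d K) p := \rsum_(s : {ffun 'I_K -> bool})
  linf (analysis D (synthesis Phi (@cps K c p s))) ^ 2.
have upperE (p : {perm 'I_K}) (i : 'I_K) : p i = o -> obj Psi p < 2 ^ K * (q Psi p i + A * (G * W)).
  move=> pi.
  apply: (@Rle_lt_trans _ (\rsum_(s : {ffun 'I_K -> bool})
    (dot (Psi i) (synthesis Phi (cps c p s)) ^ 2 + A * \rsum_(j < K) noisy p i j s))).
    by apply: rsum_le => s _; apply: upper.
  rewrite rsumD rsumZ exchange_big /=.
  have -> : \rsum_(s : {ffun 'I_K -> bool}) dot (Psi i) (synthesis Phi (cps c p s)) ^ 2
     = 2 ^ K * q Psi p i.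
    rewrite /q -rademacher_moment2; apply: eq_bigr => s _; by rewrite dot_synthesis_cps.
  (* The atom [j0], which has moved, makes the total strict. *)
  have H : \rsum_(j < K) \rsum_(s : {ffun 'I_K -> bool}) noisy p i j s
      < \rsum_(j < K) (2 ^ K * G * w j).
    apply: (rsum_lt (i0 := j0)) => [j|]; rewrite Rmult_assoc.
      by case: (noisy_le p i j pi).
    by case: (noisy_le p i j0 pi) => _; apply.
  rewrite rsumZ -/W in H.
  have := Rmult_lt_compat_l A _ _ ltac:(lra) H => H'.
  rewrite Rmult_plus_distr_l; apply: Rplus_lt_compat_l.
  apply: (Rlt_le_trans _ _ _ H'); apply: Req_le; ring.
have lowerE p i : 2 ^ K * q Phi p i <= obj Phi p.
  rewrite /q -rademacher_moment2; apply: rsum_le => s _.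
  rewrite -dot_synthesis_cps; exact: (linf_sqr_ge _ i).
(* Both phi_i and psi_i are unit vectors, so the frame identity makes [g] sum to 0;
   [rsum_perm_fix_avg] with the squares of [c] then leaves [lam * g i], and [g i = w i]. *)
have gain : \rsum_(i < K) \big[Rplus/0]_(p : {perm 'I_K} | p i == o)
      (q Phi p i + -1 * q Psi p i) = INR (K`!)%N / INR K * (lam * W).
  rewrite /W -!rsumZ; apply: eq_bigr => i _.
  pose g l := dot (Phi i) (Phi l) ^ 2 + -1 * dot (Psi i) (Phi l) ^ 2.
  have g0 : \rsum_(l < K) g l = 0.
    rewrite rsumD rsumZ.
    have HG (D : dict d K) : in_D D -> \rsum_(l < K) dot (D i) (Phi l) ^ 2 = A.
      move=> HD; rewrite -[RHS]Rmult_1_r -(dot_unit (HD i)) -(proj2 HF).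
      by apply: eq_bigr => l _; rewrite dotC.
    by rewrite !HG //; [ring|exact: (proj1 HF)].
  have gi : g i = w i by rewrite /g /w /al (dot_unit (proj1 HF i)) /=; ring.
  have := @rsum_perm_fix_avg K o i (fun l => c l ^ 2) g K1 c_norm g0.
  rewrite gi => <-; apply: eq_bigr => p _.
  by rewrite /q -rsumZ -rsumD; apply: eq_bigr => l _; rewrite /g /=; ring.
have fact0 : 0 < INR (K`!)%N by apply: lt_0_INR; apply/ltP; exact: fact_gt0.
have norm0 : 0 < / (INR (2 ^ K)%N * INR (K`!)%N).
  by apply: Rinv_0_lt_compat; rewrite INR_exp2; apply: Rmult_lt_0_compat.
apply: Rmult_lt_compat_l => //; rewrite -/(obj Psi) -/(obj Phi).
(* The index that carries c_1 under [p]. *)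
pose ip (p : {perm 'I_K}) := (p^-1)%g o.
have pip (p : {perm 'I_K}) : p (ip p) = o by rewrite /ip permKV.
apply: (@Rlt_le_trans _ (\rsum_(p : {perm 'I_K}) 2 ^ K * q Phi p (ip p))); last first.
  by apply: rsum_le => p _; apply: lowerE.
apply: (@Rlt_le_trans _
  (\rsum_(p : {perm 'I_K}) 2 ^ K * (q Psi p (ip p) + A * (G * W)))).
  by apply: (rsum_lt (i0 := 1%g)) => [p|]; [apply: Rlt_le|]; apply: upperE.
rewrite !rsumZ; apply: Rmult_le_compat_l; first by lra.
rewrite rsumD rsum_const.
have -> : INR #|(fun _ : {perm 'I_K} => true)| = INR (K`!)%N by rewrite -card_Sn.
have Hg : \rsum_(p : {perm 'I_K}) (q Phi p (ip p) + -1 * q Psi p (ip p))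
    = INR (K`!)%N / INR K * (lam * W).
  rewrite -gain (perm_partition o); apply: eq_bigr => i _; apply: eq_bigr => p /eqP pi.
  by rewrite /ip -pi permK.
rewrite rsumD rsumZ in Hg.
(* The tail budget, summed over the permutations, equals the gain; strictness was secured in
   [upperE]. *)
have -> : INR (K`!)%N * (A * (G * W)) = INR (K`!)%N / INR K * (lam * W).
  by rewrite /G; field; lra.
by lra.
Qed.

Theorem theorem2 (d K : nat) (Phi : dict d K) (A : R) (c : nat -> R)
  (hd : (0 < d)%N) (hK : (1 < K)%N)
  (hframe : is_untf Phi A)
  (hA : A = INR K / INR d)
  (hsorted : forall i j : nat, (i <= j)%N -> (j < K)%N -> c j <= c i)
  (hnonneg : forall i : nat, (i < K)%N -> 0 <= c i)
  (hnorm : sqrt (\big[Rplus/0]_(i < K) (c i) ^ 2) = 1)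
  (hgap : c 0%N > c 1%N + 2 * coherence Phi * \big[Rplus/0]_(i < K) Rabs (c i)) :
  local_max_on_D (objective Phi c) Phi /\
  (forall eps : R,
     eps < / 5 ->
     eps <= (1 - 2 * ((c 1%N + coherence Phi * \big[Rplus/0]_(i < K) Rabs (c i))
                       / (c 1%N + c 0%N))) ^ 2
            / (2 * A * ln (2 * A * INR K
                           / ((c 0%N) ^ 2 - (1 - (c 0%N) ^ 2) / (INR K - 1)))) ->
     forall Psi : dict d K, in_D Psi ->
       0 < dict_dist Psi Phi -> dict_dist Psi Phi <= eps ->
       objective Phi c Psi < objective Phi c Phi).
Proof.
pose o : 'I_K := Ordinal (ltnW hK).
have A1 := untf_const_ge1 o hframe.
have K2 : 2 <= INR K by apply: (le_INR 2); apply/leP.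
have c1_ge0 := hnonneg 1%N hK.
have norm1 : \rsum_(i < K) c i ^ 2 = 1.
  rewrite -(sqrt_sqrt (\rsum_(i < K) c i ^ 2)) ?hnorm; first by ring.
  by apply: rsum_ge0 => i _; apply: pow2_ge_0.
pose m := coherence Phi * \rsum_(l < K) Rabs (c l).
have m0 : 0 <= m.
  by apply: Rmult_le_pos; [exact: coherence_ge0|apply: rsum_ge0 => l _; exact: Rabs_pos].
have gap : c 1%N + 2 * m < c 0%N by rewrite /m; lra.
have c0_sqr : c 0%N ^ 2 <= 1.
  rewrite -norm1.
  exact: (@rsum_term_le _ (fun i : 'I_K => c i ^ 2) o (fun i => pow2_ge_0 _)).
(* c_1^2 exceeds the mean of the squares, strictly because c_2 < c_1; this makes [lam] positive. *)
have Kc0 : 1 < INR K * c 0%N ^ 2.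
  have <- : \rsum_(i < K) c 0%N ^ 2 = INR K * c 0%N ^ 2 by rewrite rsum_const card_ord.
  rewrite -[X in X < _]norm1.
  apply: (rsum_lt (i0 := Ordinal hK)) => [i|] /=; last by nra.
  by have := hsorted 0%N i (leq0n i) (ltn_ord i); have := hnonneg i (ltn_ord i); nra.
set lam := c 0%N ^ 2 - (1 - c 0%N ^ 2) / (INR K - 1).
have lam_bd : 0 < lam <= 1.
  have -> : lam = (INR K * c 0%N ^ 2 - 1) / (INR K - 1) by rewrite /lam; field; lra.
  split; first by apply: Rdiv_lt_0_compat; lra.
  apply: (Rmult_le_reg_r (INR K - 1)); first by lra.
  have -> : (INR K * c 0%N ^ 2 - 1) / (INR K - 1) * (INR K - 1) = INR K * c 0%N ^ 2 - 1.
    by field; lra.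
  by nra.
pose del := (c 0%N - c 1%N - 2 * m) / (c 1%N + c 0%N).
have delE : 1 - 2 * ((c 1%N + m) / (c 1%N + c 0%N)) = del by rewrite /del; field; lra.
rewrite -/m delE.
have del0 : 0 < del by apply: Rdiv_lt_0_compat; lra.
set L := ln _.
have L0 : 0 < L.
  rewrite /L -ln_1; apply: ln_increasing; first by lra.
  apply: (Rmult_lt_reg_r lam); first by lra.
  have -> : 2 * A * INR K / lam * lam = 2 * A * INR K by field; lra.
  by nra.
have AL : 0 < 2 * A * L by apply: Rmult_lt_0_compat; lra.
have strict eps : eps < / 5 -> eps <= del ^ 2 / (2 * A * L) ->
    forall Psi : dict d K, in_D Psi -> 0 < dict_dist Psi Phi ->
    dict_dist Psi Phi <= eps -> objective Phi c Psi < objective Phi c Phi.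
  move=> e5 He Psi HPsi D0 De; apply: (@objective_lt _ _ _ _ A c eps) => //.
  have := Rmult_le_compat_l (2 * A * L) _ _ (Rlt_le _ _ AL) He.
  by have -> : 2 * A * L * (del ^ 2 / (2 * A * L)) = del ^ 2 by field; lra.
(* 1/6 serves as a value strictly below 1/5; the radius itself is then an admissible [eps]. *)
split => //; exists (Rmin (/ 6) (del ^ 2 / (2 * A * L))); split.
  by apply: Rmin_pos; [lra|apply: Rdiv_lt_0_compat => //; apply: pow_lt].
move=> Psi HPsi Hr.
case: (Rle_lt_dec (dict_dist Psi Phi) 0) => [D0|D0]; last first.
  apply: Rlt_le; apply: (strict (Rmin (/ 6) (del ^ 2 / (2 * A * L)))) => //.
  - by apply: Rle_lt_trans (Rmin_l _ _) _; lra.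
  - exact: Rmin_r.
  - exact: Rlt_le.
(* At distance 0 the dictionaries agree entry by entry. *)
suff -> : Psi = Phi by apply: Rle_refl.
apply: functional_extensionality => i; apply: functional_extensionality => j.
have H := Rle_trans _ _ _ (dict_dist_ge Psi Phi i) D0.
have H0 := sqrt_pos (dot (fun k => Psi i k - Phi i k) (fun k => Psi i k - Phi i k)).
have E : dot (fun k => Psi i k - Phi i k) (fun k => Psi i k - Phi i k) = 0.
  apply: sqrt_eq_0; [exact: dot_self_ge0|exact: Rle_antisym].
suff : Psi i j - Phi i j = 0 by lra.
apply: (@rsum_sqr_eq0 _ (fun k => Psi i k - Phi i k)).
apply: Req_le; rewrite -[RHS]E; apply: eq_bigr => k _; rewrite /=; ring.
Qed.
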